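(* Consider the $K$-armed bandit problem with unit-variance normal rewards, where either $K=N^{\zeta+o(1)}\to\infty$ for some $0<\zeta<1$, or $K$ is fixed (and $\zeta=0$), as $N\to\infty$. If a bandit algorithm is uniformly good, then for all $\Delta_K\to 0$ at a sub-polynomial rate, $$\liminf_{N\to\infty}\Big[\inf_{\boldsymbol{\mu}\in\Theta(\Delta_K)}\frac{R_N(\boldsymbol{\mu})}{r(\boldsymbol{\mu})\log N}\Big]\ \geq\ 1-\zeta .$$
   Context: Setting: there are $K=K(N)$ arms and a total of $N$ rewards is to be collected. The rewards $X_{k1},X_{k2},\ldots$ of arm $k$ are i.i.d. $N(\mu_k,1)$, independent across arms; $\boldsymbol{\mu}=\boldsymbol{\mu}_K=(\mu_1,\ldots,\mu_K)\in\mathbb{R}^K$ is unknown. A bandit algorithm chooses sequentially, for each $N$ (with $K=K(N)$), the arm from which the next reward is drawn, on the basis of past choices and observed rewards (possibly with independent randomization). $N_k$ is the number of rewards drawn from arm $k$ among the $N$ total rewards, and $P_{\boldsymbol{\mu}}$, $E_{\boldsymbol{\mu}}$ denote probability and expectation under $\boldsymbol{\mu}$. Let $\mu_*=\max_{1\le k\le K}\mu_k$. Regret: $R_N(\boldsymbol{\mu})=\sum_{k=1}^K(\mu_*-\mu_k)E_{\boldsymbol{\mu}}N_k$. Let $r(\boldsymbol{\mu})=\sum_{k:\mu_k<\mu_*}\frac{2}{\mu_*-\mu_k}$ and $J(\boldsymbol{\mu})=\#\{k:\mu_k<\mu_*\}$. $(\Delta_K)$ is a sequence of positive numbers indexed by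 the number of arms $K$ (so it is a constant as $N\to\infty$ when $K$ is fixed); $\Delta_K\to0$ at a sub-polynomial rate means that, as $K\to\infty$, $\Delta_K\to0$ and $\Delta_K K^{\epsilon}\to\infty$ for all $\epsilon>0$. $$\Theta(\Delta_K)=\Big\{\boldsymbol{\mu}\in\mathbb{R}^K:\ \max_{k:\mu_k<\mu_*}\mu_k\le\mu_*-\Delta_K,\ \max_k|\mu_k|\le\Delta_K^{-1},\ J(\boldsymbol{\mu})\ge\Delta_K K\Big\}.$$ Uniformly good: for any $\Delta_K\to0$ at a sub-polynomial rate, $\sup_{\boldsymbol{\mu}\in\Theta(\Delta_K)}R_N(\boldsymbol{\mu})=o(KN^{\epsilon})$ as $N\to\infty$ for all $\epsilon>0$. (Suprema over an empty parameter set are taken as $0$, infima as $+\infty$.) *)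

(* Defs.v *)
From HB Require Import structures.
From mathcomp Require Export all_boot all_order all_algebra.
From mathcomp Require Export all_classical all_reals all_analysis.
Export Order.TTheory GRing.Theory Num.Theory.
Export numFieldNormedType.Exports.

Set Implicit Arguments.
Unset Strict Implicit.
Unset Printing Implicit Defensive.

Local Open Scope classical_set_scope.
Local Open Scope ring_scope.

Definition mutually_independent (R : realType) (d : measure_display)
    (T : measurableType d) (P : probability T R) (I : eqType)
    (F : I -> set (set T)) : Prop :=
  forall (s : seq I) (E : I -> set T),
    uniq s -> (forall i, i \in s -> F i (E i)) ->
    P (\bigcap_(i in [set` s]) E i) = (\prod_(i <- s) P (E i))%E.

(* One sample space carrying all the laws [P_mu] of a [K]-armed problem.
   [reward k j] is the reward X_{k,j+1} of arm [k], and [seed] is the extra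
   randomness available to the algorithm: its law does not depend on [mu] and
   it is independent of the rewards. *)
Record bandit_model (R : realType) (K : nat) := BanditModel {
  sample_disp : measure_display;
  sample_space : measurableType sample_disp;
  seed_disp : measure_display;
  seed_space : measurableType seed_disp;
  reward : 'I_K -> nat -> {mfun sample_space >-> R};
  seed : {mfun sample_space >-> seed_space};
  law : ('I_K -> R) -> probability sample_space R;
  reward_law : forall (mu : 'I_K -> R) (k : 'I_K) (j : nat) (B : set R),
    measurable B ->
    distribution (law mu) (reward k j) B = normal_prob (mu k) 1 B;
  seed_law : forall (mu mu' : 'I_K -> R) (B : set seed_space),
    measurable B ->
    distribution (law mu) seed B = distribution (law mu') seed B;
  reward_seed_independent : forall mu : 'I_K -> R,
    mutually_independent (law mu)
      (fun i : option ('I_K * nat) =>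
         if i is Some (k, j)
         then preimage_set_system setT (reward k j) measurable
         else preimage_set_system setT seed measurable)
}.

(* A history is the list of (arm, observed reward) pairs, oldest first; its
   length is the current time.  Measurability is required for each sequence of
   past arms, arms being discrete. *)
Record bandit_algorithm (R : realType) (K : nat) (d : measure_display)
    (U : measurableType d) := BanditAlgorithm {
  choose_arm : U -> seq ('I_K * R) -> 'I_K;
  choose_arm_measurable : forall (t : nat) (a : t.-tuple 'I_K) (k : 'I_K),
    measurable [set uy : U * t.-tuple R |
                 choose_arm uy.1 (zip a uy.2) = k]
}.

Definition pulls (R : realType) (K : nat) (h : seq ('I_K * R)) (k : 'I_K)
  : nat := count (fun p => p.1 == k) h.

(* When arm [k] is chosen, the next unused reward of its stream is observed. *)
Fixpoint history (R : realType) (K : nat) (d : measure_display)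
    (U : measurableType d) (A : bandit_algorithm R K U)
    (x : 'I_K -> nat -> R) (u : U) (n : nat) : seq ('I_K * R) :=
  if n is n'.+1 then
    let h := history A x u n' in
    let k := choose_arm A u h in
    rcons h (k, x k (pulls h k))
  else [::].

Definition arm_count (R : realType) (K : nat) (M : bandit_model R K)
    (A : bandit_algorithm R K (seed_space M)) (N : nat) (k : 'I_K)
    (w : sample_space M) : nat :=
  pulls (history A (fun l j => reward M l j w) (seed M w) N) k.

(* The maximum of [mu], the supremum of a finite set (nonempty if [0 < K]). *)
Definition best_mean (R : realType) (K : nat) (mu : 'I_K -> R) : R :=
  sup (range mu).

Definition regret (R : realType) (K : nat) (M : bandit_model R K)
    (A : bandit_algorithm R K (seed_space M)) (N : nat) (mu : 'I_K -> R)
  : \bar R :=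
  (\sum_(k < K) (best_mean mu - mu k)%:E *
     'E_(law M mu)[fun w => (arm_count A N k w)%:R])%E.

Definition complexity (R : realType) (K : nat) (mu : 'I_K -> R) : R :=
  \sum_(k < K | mu k < best_mean mu) 2 / (best_mean mu - mu k).

Definition num_suboptimal (R : realType) (K : nat) (mu : 'I_K -> R) : nat :=
  #|[pred k | mu k < best_mean mu]|.

Definition Theta (R : realType) (K : nat) (D : R) : set ('I_K -> R) :=
  [set mu | [/\ forall k, mu k < best_mean mu -> mu k <= best_mean mu - D,
                forall k, `|mu k| <= D^-1
              & D * K%:R <= (num_suboptimal mu)%:R]].

Definition subpolynomial (R : realType) (Delta : nat -> R) : Prop :=
  [/\ forall K : nat, (0 < K)%N -> 0 < Delta K,
      Delta K @[K --> \oo] --> 0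
    & forall eps : R, 0 < eps ->
        Delta K * K%:R `^ eps @[K --> \oo] --> +oo].

(* Regrets are nonnegative, so [maxe 0] only serves to make the supremum over
   an empty [Theta] equal to 0 rather than -oo. *)
Definition worst_regret (R : realType) (K : nat) (M : bandit_model R K)
    (A : bandit_algorithm R K (seed_space M)) (N : nat) (D : R) : \bar R :=
  maxe 0%E (ereal_sup [set regret A N mu | mu in @Theta R K D]).

Definition uniformly_good (R : realType) (K : nat -> nat)
    (M : forall N, bandit_model R (K N))
    (A : forall N, bandit_algorithm R (K N) (seed_space (M N))) : Prop :=
  forall Delta : nat -> R, subpolynomial Delta ->
  forall eps : R, 0 < eps ->
    (worst_regret (A N) N (Delta (K N)) / ((K N)%:R * N%:R `^ eps)%:E)%E
      @[N --> \oo] --> 0%E.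

(* The number of arms is [N ^ (zeta + o(1))], tending to infinity, for some
   [0 < zeta < 1], or it is fixed and [zeta = 0]. *)
Definition arms_growth (R : realType) (K : nat -> nat) (zeta : R) : Prop :=
  [/\ 0 < zeta, zeta < 1, (K N)%:R @[N --> \oo] --> (+oo : set_system R)
    & exists e : nat -> R, e N @[N --> \oo] --> 0 /\
        \forall N \near \oo, (K N)%:R = N%:R `^ (zeta + e N) ]
  \/ (zeta = 0 /\ exists K0 : nat, forall N, K N = K0).

(* Main.v *)
From HB Require Import structures.
Require Import Defs.
From mathcomp Require Import measurable_realfun zify ring lra.

(* Let k be suboptimal for mu, with gap g, and let mu' raise the mean of k by
   g + eta Delta, so that k is the best arm of mu'.  As mu' still lies in a
   class Theta(Delta') with Delta' subpolynomial, uniform goodness bounds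
   P_mu'(N_k <= x), for x <= N/2, by K N^(eps-1) up to a factor 1/Delta.
   Passing from P_mu' to P_mu costs exp((1+o(1)) x g^2/2) on {N_k <= x}, so that
   P_mu(N_k <= x) tends to 0 for x = (2+o(1))(1-zeta) log N / g^2.  Hence
   E_mu N_k is at least about x, uniformly in k and mu, and summing over k gives
   the bound.

   No conditional expectations are needed: on the event that the arms pulled
   form a given sequence a, the history is a function of the seed and of the
   rewards that a reads, which are finitely many fixed independent variables.
   The log-likelihood ratio is bounded from below there, outside an event of
   probability exp(-t), by comparing with a third law in which the mean of k is
   lowered: the corresponding likelihood ratio has integral at most 1. *)

Set Implicit Arguments.
Unset Strict Implicit.
Unset Printing Implicit Defensive.

Local Open Scope classical_set_scope.
Local Open Scope ring_scope.

(** * Change of measure for one normal variable *)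

(** [h] agrees [mu]-almost everywhere with the Radon-Nikodym derivative of [nu], both having the
    same integral over every measurable set. *)
Lemma ge0_integral_density (R : realType) (d : measure_display)
    (T : measurableType d) (nu : {finite_measure set T -> \bar R})
    (mu : {sigma_finite_measure set T -> \bar R}) (h f : T -> \bar R) :
  mu.-integrable [set: T] h -> (forall x, 0 <= h x)%E ->
  (forall B, measurable B -> nu B = \int[mu]_(x in B) h x)%E ->
  measurable_fun [set: T] f -> (forall x, 0 <= f x)%E ->
  (\int[nu]_x f x = \int[mu]_x (f x * h x))%E.
Proof.
move=> ih h0 nuE mf f0.
have numu : nu `<< mu.
  apply/null_content_dominatesP => B mB muB0; rewrite nuE//.
  apply: null_set_integral => //.
  exact: measurable_funTS (measurable_int _ ih).
rewrite -(Radon_Nikodym_SigmaFinite.change_of_variables numu)//.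
have irn := Radon_Nikodym_SigmaFinite.f_integrable numu.
apply: ae_eq_integral => //.
- by apply: emeasurable_funM => //; exact: measurable_int irn.
- by apply: emeasurable_funM => //; exact: measurable_int ih.
- apply: ae_eqe_mul2l; apply: integral_ae_eq => //.
    exact: measurable_int ih.
  by move=> B _ mB; rewrite -Radon_Nikodym_SigmaFinite.f_integral// nuE.
Qed.

(** Likelihood ratio of N(m', 1) to N(m, 1) at [x]. *)
Definition tilt (R : realType) (m m' x : R) : R :=
  expR ((m' - m) * (x - m) - (m' - m) ^+ 2 / 2).

Lemma measurable_tilt (R : realType) (m m' : R) :
  measurable_fun [set: R] (tilt m m').
Proof.
apply: measurableT_comp => //; apply: measurable_funB => //.
by apply: measurable_funM => //; exact: measurable_funB.
Qed.

Lemma normal_pdf_tilt (R : realType) (m m' x : R) :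
  normal_pdf m' 1 x = normal_pdf m 1 x * tilt m m' x.
Proof.
rewrite !normal_pdfE ?oner_neq0// -mulrA; congr (_ * _).
rewrite /normal_fun /tilt -expRD; congr expR; rewrite expr1n.
by field.
Qed.

Lemma ge0_integral_normal_tilt (R : realType) (m m' : R) (f : R -> \bar R) :
  measurable_fun [set: R] f -> (forall x, 0 <= f x)%E ->
  (\int[normal_prob m' 1]_x f x =
   \int[normal_prob m 1]_x (f x * (tilt m m' x)%:E))%E.
Proof.
move=> mf f0.
have pdfE p (g : R -> \bar R) : measurable_fun [set: R] g ->
    (forall x, 0 <= g x)%E ->
    (\int[normal_prob p 1]_x g x =
     \int[lebesgue_measure]_x (g x * (normal_pdf p 1 x)%:E))%E.
  move=> mg g0; apply: ge0_integral_density => //.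
    exact: integrable_normal_pdf.
  by move=> x; rewrite lee_fin normal_pdf_ge0.
rewrite (pdfE m' f)// (pdfE m (fun x => f x * (tilt m m' x)%:E)%E).
- apply: eq_integral => x _; rewrite -muleA; congr (_ * _)%E.
  by rewrite -EFinM (normal_pdf_tilt m) mulrC.
- apply: emeasurable_funM => //.
  apply: measurableT_comp; last exact: measurable_tilt.
  exact: EFin_measurable.
- by move=> x; apply: mule_ge0 => //; rewrite lee_fin expR_ge0.
Qed.

(* [normal_prob] is a measure on [measurableTypeR R], whose display is not that
   of the measurable type [R]; the identity transports it. *)
Definition to_real (R : realType) (x : measurableTypeR R) : R := x.

Lemma measurable_to_real (R : realType) :
  measurable_fun [set: measurableTypeR R] (@to_real R).
Proof. by move=> _ B mB; rewrite setTI. Qed.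

HB.instance Definition _ (R : realType) :=
  isMeasurableFun.Build _ _ (measurableTypeR R) R (@to_real R)
    (@measurable_to_real R).

Definition gaussian (R : realType) (m : R) : probability R R :=
  distribution (normal_prob m 1) (@to_real R).

Lemma ge0_integral_gaussian_tilt (R : realType) (m m' : R) (f : R -> \bar R) :
  measurable_fun [set: R] f -> (forall x, 0 <= f x)%E ->
  (\int[gaussian m']_x f x =
   \int[gaussian m]_x (f x * (tilt m m' x)%:E))%E.
Proof.
move=> mf f0.
have mt : measurable_fun [set: R] (fun x => f x * (tilt m m' x)%:E)%E.
  apply: emeasurable_funM => //; apply/measurable_EFinP.
  exact: measurable_tilt.
have t0 x : (0 <= f x * (tilt m m' x)%:E)%E.
  by rewrite mule_ge0// lee_fin expR_ge0.
have := ge0_integral_distribution (P := normal_prob m' 1) (@to_real R) mf f0.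
move=> ->.
have := ge0_integral_distribution (P := normal_prob m 1) (@to_real R) mt t0.
move=> ->.
exact: ge0_integral_normal_tilt.
Qed.

(** * Adjoining independent variables one at a time *)

Lemma set_mem_cons (I : eqType) (i : I) (s : seq I) :
  [set` i :: s] = i |` [set` s].
Proof.
apply/seteqP; split => j /=; rewrite inE.
  by move=> /orP[/eqP|]; [left|right].
by move=> [->|->]; rewrite ?eqxx ?orbT.
Qed.

(** Rectangles are stable under intersection, generate the product sigma-algebra and include the
    whole space, where [m1] is finite. *)
Lemma measure_unique_rectangles (R : realType) (d1 d2 : measure_display)
    (T1 : measurableType d1) (T2 : measurableType d2)
    (m1 m2 : {measure set (T1 * T2) -> \bar R}) :
  (m1 [set: T1 * T2] < +oo)%E ->
  (forall (A : set T1) (B : set T2), measurable A -> measurable B ->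
     m1 (A `*` B) = m2 (A `*` B)) ->
  forall C : set (T1 * T2), measurable C -> m1 C = m2 C.
Proof.
move=> m1oo m12 C mC.
pose G : set (set (T1 * T2)) :=
  [set A `*` B | A in measurable & B in measurable].
apply: (measure_unique G (fun=> [set: T1 * T2])) => //.
- by rewrite measurable_prod_measurableType.
- move=> _ _ [A1 mA1 [B1 mB1 <-]] [A2 mA2 [B2 mB2 <-]].
  rewrite -setXI; exists (A1 `&` A2); first exact: measurableI.
  by exists (B1 `&` B2) => //; exact: measurableI.
- by move=> _; exists setT => //; exists setT => //; rewrite setXTT.
- by rewrite bigcup_const.
- by move=> _ [A mA [B mB <-]]; exact: m12.
Qed.

(** The pairing has a name so that a measurable-function structure can be attached to it. *)
Definition pair_fun (T S1 S2 : Type) (Y : T -> S1) (Z : T -> S2) (w : T) :=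
  (Y w, Z w).

HB.instance Definition _ (d d1 d2 : measure_display) (T : measurableType d)
    (S1 : measurableType d1) (S2 : measurableType d2)
    (Y : {mfun T >-> S1}) (Z : {mfun T >-> S2}) :=
  isMeasurableFun.Build _ _ T (S1 * S2)%type (pair_fun Y Z)
    (measurable_fun_pair (measurable_funPT Y) (measurable_funPT Z)).

Section independence.
Context (R : realType) (d : measure_display) (T : measurableType d)
  (P : probability T R) (I : eqType) (X : I -> {mfun T >-> R}).

(* Quantifying over finitely many further variables [X i], [i \notin s], is what
   allows new variables to be adjoined to [Y] one at a time. *)
Definition independent_off (d' : measure_display) (S : measurableType d')
    (Y : T -> S) (s : seq I) : Prop :=
  forall (s' : seq I) (B : I -> set R) (C : set S),
    uniq s' -> (forall i, i \in s' -> i \notin s) ->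
    (forall i, measurable (B i)) -> measurable C ->
    P (Y @^-1` C `&` \bigcap_(i in [set` s']) (X i @^-1` B i)) =
    (P (Y @^-1` C) * \prod_(i <- s') P (X i @^-1` B i))%E.

Lemma independent_off_comp (d1 d2 : measure_display)
    (S1 : measurableType d1) (S2 : measurableType d2)
    (Y : T -> S1) (h : S1 -> S2) (s : seq I) :
  measurable_fun [set: S1] h ->
  independent_off Y s -> independent_off (h \o Y) s.
Proof.
move=> mh indY s' B C us' s's mB mC.
rewrite comp_preimage; apply: indY => //.
by rewrite -[X in measurable X]setTI; exact: mh.
Qed.

Context (d' : measure_display) (S : measurableType d') (Y : {mfun T >-> S}).
Context (s : seq I) (i : I) (nis : i \notin s) (indY : independent_off Y s).

Lemma independent_off_law (nu : probability R R) (C : set (S * R)) :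
  (forall B, measurable B -> P (X i @^-1` B) = nu B) -> measurable C ->
  distribution P (pair_fun Y (X i)) C = (distribution P Y \x nu)%E C.
Proof.
move=> nuE mC; apply/esym.
apply: product_measure_unique => // A B mA mB.
have := indY (s' := [:: i]) (B := fun=> B) (C := A) isT _ (fun=> mB) mA.
rewrite big_seq1 set_cons1 bigcap_set1 nuE//; apply.
by move=> j; rewrite inE => /eqP ->.
Qed.

(** With the event on the variables of [s'] fixed, both sides are finite measures in [C]. On a
    rectangle the condition on [X i] joins those of [s'], and independence of [Y] off [s] applies to
    [i :: s']. *)
Lemma independent_off_cons : independent_off (pair_fun Y (X i)) (i :: s).
Proof.
move=> s' B C us' s's mB mC.
set D := \bigcap_(j in _) _.
have mX j (A : set R) : measurable A -> measurable (X j @^-1` A).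
  by move=> mA; rewrite -[_ @^-1` _]setTI; exact: measurable_funPT.
have mD : measurable D.
  by apply: fin_bigcap_measurable => // j _; exact: mX.
have mP : measurable_fun [set: T] (pair_fun Y (X i)).
  exact: measurable_funPT.
pose c := fine (\prod_(j <- s') P (X j @^-1` B j)).
have c01 : 0 <= c.
  by rewrite fine_ge0// prode_ge0.
have cE : (\prod_(j <- s') P (X j @^-1` B j))%E = c%:E.
  rewrite fineK//; elim/big_ind : _ => //= [x y xf yf|j _].
    exact: fin_numM.
  exact: fin_num_measure (mX _ _ (mB j)).
rewrite cE muleC.
have finP (E : set T) : measurable E -> (P E < +oo)%E.
  by move=> mE; rewrite ltey_eq fin_num_measure.
pose m0 : {measure set T -> \bar R} := mrestr P mD.
have [m1 m1E] : exists m1 : {measure set (S * R) -> \bar R},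
    forall E, m1 E = P (pair_fun Y (X i) @^-1` E `&` D).
  by unshelve eexists (pushforward m0 (pair_fun Y (X i))).
pose m2 : {measure set (S * R) -> \bar R} :=
  mscale (NngNum c01) (distribution P (pair_fun Y (X i))).
rewrite -m1E; apply: (@measure_unique_rectangles _ _ _ _ _ m1 m2) => //.
  by rewrite m1E; apply: finP; rewrite preimage_setT setTI.
move=> A1 A2 mA1 mA2.
have disj (B' : I -> set R) (t : seq I) : (forall j, measurable (B' j)) ->
    uniq t -> {subset t <= i :: s'} ->
    P (Y @^-1` A1 `&` \bigcap_(j in [set` t]) (X j @^-1` B' j)) =
    (P (Y @^-1` A1) * \prod_(j <- t) P (X j @^-1` B' j))%E.
  move=> mB' ut ts'; apply: indY => // j /ts'.
  rewrite inE => /orP[/eqP ->//|/s's].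
  by rewrite inE negb_or => /andP[].
have is' : i \notin s'.
  by apply/negP => /s's; rewrite inE eqxx.
(* Since [i] is not in [s'], overwriting [B] at [i] puts the condition on [X i] into the same family
   without changing [D]. *)
pose B' j := if j == i then A2 else B j.
have mB' j : measurable (B' j) by rewrite /B'; case: ifP.
have B'i : B' i = A2 by rewrite /B' eqxx.
have B's' j : j \in s' -> B' j = B j.
  by move=> js'; rewrite /B'; case: eqP => // ji; rewrite -ji js' in is'.
have DE : D = \bigcap_(j in [set` s']) (X j @^-1` B' j).
  by apply: eq_bigcapr => j /= js'; rewrite B's'.
have := disj B' (i :: s') mB'.
have := disj B' [:: i] mB' isT.
rewrite /= us' is' big_seq1 set_cons1 bigcap_set1 B'i => d1 d2.
rewrite m1E /m2 /mscale /distribution /pushforward/=.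
have E12 : pair_fun Y (X i) @^-1` (A1 `*` A2) = Y @^-1` A1 `&` X i @^-1` A2.
  by [].
rewrite -[distribution _ _ _]/(P (pair_fun Y (X i) @^-1` (A1 `*` A2))) E12.
rewrite d1; last by move=> j; rewrite !inE => ->.
move: d2; rewrite set_mem_cons bigcap_setU1 B'i -DE setIA => -> //.
rewrite big_cons B'i muleA muleC; congr (_ * _)%E.
by rewrite -cE; apply: eq_big_seq => j js'; rewrite B's'.
Qed.
End independence.

(** * Likelihood ratios of the seed and finitely many rewards *)

Section observations.
Context (R : realType) (d d' : measure_display) (T : measurableType d)
  (U : measurableType d') (I : eqType) (X : I -> {mfun T >-> R})
  (Z : {mfun T >-> U}).

(** Recursion on [s] makes [observations_cons] hold by computation. *)
Fixpoint values (s : seq I) (w : T) : (size s).-tuple R :=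
  if s is i :: s' then cons_tuple (X i w) (values s' w) else nil_tuple R.

Lemma valuesE (s : seq I) (w : T) : values s w = [seq X i w | i <- s] :> seq R.
Proof. by elim: s => //= i s ->. Qed.

Lemma measurable_values (s : seq I) : measurable_fun [set: T] (values s).
Proof.
elim: s => [|i s IHs] /=; first exact: measurable_cst.
exact: measurable_cons.
Qed.

Definition observations (s : seq I) : T -> U * (size s).-tuple R :=
  pair_fun Z (values s).

HB.instance Definition _ (s : seq I) :=
  isMeasurableFun.Build _ _ T (U * (size s).-tuple R)%type (observations s)
    (measurable_fun_pair (measurable_funPT Z) (@measurable_values s)).

Definition push_value (n : nat) (z : (U * n.-tuple R) * R) :
    U * n.+1.-tuple R :=
  (z.1.1, cons_tuple z.2 z.1.2).

Lemma measurable_push_value (n : nat) :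
  measurable_fun [set: (U * n.-tuple R) * R] (@push_value n).
Proof.
apply: measurable_fun_pair; first exact: measurableT_comp.
by apply: measurable_cons => //; exact: measurableT_comp.
Qed.

Lemma observations_cons (i : I) (s : seq I) :
  observations (i :: s) =
  @push_value (size s) \o pair_fun (observations s) (X i).
Proof. by []. Qed.

Lemma independent_off_observations (P : probability T R) (s : seq I) :
  independent_off P X Z [::] -> uniq s ->
  independent_off P X (observations s) s.
Proof.
move=> indZ; elim: s => [_|i s IHs /= /andP[nis us]].
  apply: (independent_off_comp (h := fun u => (u, nil_tuple R))) => //.
rewrite observations_cons; apply: independent_off_comp.
  exact: measurable_push_value.
by apply: independent_off_cons => //; exact: IHs.
Qed.

(** Density of the observations under the means [m'] with respect to their law under [m]; the seed
    contributes no factor, its law being the same under both. *)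
Definition likelihood (m m' : I -> R) (s : seq I)
    (z : U * (size s).-tuple R) : R :=
  \prod_(j < size s) tilt (m (tnth (in_tuple s) j)) (m' (tnth (in_tuple s) j))
                          (tnth z.2 j).

Lemma measurable_likelihood (m m' : I -> R) (s : seq I) :
  measurable_fun [set: U * (size s).-tuple R] (likelihood m m' (s := s)).
Proof.
apply: measurable_prod => j _.
apply: (measurableT_comp (measurable_tilt _ _)).
exact: (measurableT_comp (measurable_tnth _)).
Qed.

Lemma likelihood_ge0 (m m' : I -> R) (s : seq I) (z : U * (size s).-tuple R) :
  0 <= likelihood m m' z.
Proof. by apply: prodr_ge0 => j _; exact: expR_ge0. Qed.

Lemma likelihood_cons (m m' : I -> R) (i : I) (s : seq I)
    (z : (U * (size s).-tuple R) * R) :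
  likelihood m m' (push_value z : U * (size (i :: s)).-tuple R) =
  likelihood m m' z.1 * tilt (m i) (m' i) z.2.
Proof.
rewrite mulrC /likelihood big_ord_recl; congr (_ * _).
by apply: eq_bigr => j _; rewrite !(tnth_nth (m i)) !(tnth_nth i).
Qed.

Context (P P' : probability T R) (m m' : I -> R).
Context (lawX : forall i (B : set R), measurable B ->
           P (X i @^-1` B) = gaussian (m i) B).
Context (lawX' : forall i (B : set R), measurable B ->
           P' (X i @^-1` B) = gaussian (m' i) B).
Context (lawZ : forall B : set U, measurable B ->
           P (Z @^-1` B) = P' (Z @^-1` B)).
Context (indZ : independent_off P X Z [::])
  (indZ' : independent_off P' X Z [::]).

(** By induction on [s]: the head variable is independent of the observations of the tail, so
    Tonelli's theorem isolates its one-dimensional integral, where the tilt is known. *)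
Lemma change_of_measure (s : seq I) (f : U * (size s).-tuple R -> \bar R) :
  uniq s -> measurable_fun [set: U * (size s).-tuple R] f ->
  (forall z, 0 <= f z)%E ->
  (\int[distribution P' (observations s)]_z f z =
   \int[distribution P (observations s)]_z
      (f z * (likelihood m m' z)%:E))%E.
Proof.
elim: s f => [|i s IHs] f us mf f0.
  under [RHS]eq_integral do rewrite /likelihood big_ord0 mule1.
  apply: eq_measure_integral => C mC _.
  apply/esym/(lawZ (B := (fun u => (u, nil_tuple R)) @^-1` C)).
  by rewrite -[X in measurable X]setTI; apply: measurable_fun_pair.
have /andP[nis uss] := us.
have consE (Q : probability T R) (q : R)
    (g : U * (size (i :: s)).-tuple R -> \bar R) :
    independent_off Q X Z [::] ->
    (forall B : set R, measurable B -> Q (X i @^-1` B) = gaussian q B) ->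
    measurable_fun [set: U * (size (i :: s)).-tuple R] g ->
    (forall z, 0 <= g z)%E ->
    (\int[distribution Q (observations (i :: s))]_z g z =
     \int[distribution Q (observations s) \x gaussian q]_z
       g (push_value z))%E.
  move=> indQ lawQ mg g0.
  have mgp : measurable_fun [set: (U * (size s).-tuple R) * R]
      (g \o @push_value (size s)).
    by apply: measurableT_comp => //; exact: measurable_push_value.
  rewrite ge0_integral_distribution// observations_cons.
  rewrite -(@ge0_integral_distribution _ _ _ _ _ Q
    (pair_fun (observations s) (X i)) (g \o @push_value (size s)))//;
    last by move=> z; exact: g0.
  rewrite /comp; apply: eq_measure_integral => C mC _.
  apply: (independent_off_law nis) => //.
  exact: independent_off_observations.
pose h z := f (push_value z : U * (size (i :: s)).-tuple R).
have mh : measurable_fun [set: (U * (size s).-tuple R) * R] h.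
  by apply: (measurableT_comp mf); exact: measurable_push_value.
pose k (z : (U * (size s).-tuple R) * R) :=
  (h z * (tilt (m i) (m' i) z.2)%:E)%E.
have mk : measurable_fun [set: (U * (size s).-tuple R) * R] k.
  apply: emeasurable_funM => //; apply/measurable_EFinP.
  exact: (measurableT_comp (measurable_tilt _ _)).
have k0 z : (0 <= k z)%E.
  by apply: mule_ge0; [exact: f0|rewrite lee_fin expR_ge0].
have mL := @measurable_likelihood m m' s.
rewrite (consE P' (m' i))//; last exact: lawX'.
rewrite fubini_tonelli1//.
(* The inner integral passes from mean [m' i] to [m i]; the induction hypothesis then changes the
   outer law. *)
transitivity (\int[distribution P' (observations s)]_x
    \int[gaussian (m i)]_y k (x, y))%E.
  apply: eq_integral => x _; apply: ge0_integral_gaussian_tilt => //.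
  exact: (measurableT_comp mh (pair1_measurable x)).
rewrite IHs//; last 2 first.
- exact: (measurable_fun_fubini_tonelli_F (m2 := gaussian (m i))).
- by move=> x; exact: integral_ge0.
rewrite (consE P (m i))//; last 3 first.
- exact: lawX.
- apply: emeasurable_funM => //; apply/measurable_EFinP.
  exact: measurable_likelihood.
- by move=> z; rewrite mule_ge0// lee_fin likelihood_ge0.
transitivity (\int[distribution P (observations s) \x gaussian (m i)]_z
    (k z * (likelihood m m' z.1)%:E))%E; last first.
  apply: eq_integral => z _.
  rewrite likelihood_cons EFinM /k -muleA; congr (_ * _)%E; exact: muleC.
rewrite fubini_tonelli1//.
- apply: eq_integral => x _; rewrite /fubini_F/=.
  rewrite -ge0_integralZr// ?lee_fin ?likelihood_ge0//.
  exact: measurableT_comp.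
- apply: emeasurable_funM => //; apply/measurable_EFinP.
  exact: (measurableT_comp mL).
- by move=> z; rewrite mule_ge0// lee_fin likelihood_ge0.
Qed.
End observations.

(** * Comparison of a law with a raised and a lowered one *)

Section domination.
Context (R : realType) (d d' : measure_display) (T : measurableType d)
  (U : measurableType d') (I : eqType) (X : I -> {mfun T >-> R})
  (Z : {mfun T >-> U}) (m : I -> R) (q : pred I).

Definition shift_mean (e : R) (i : I) : R := m i + (if q i then e else 0).

(** Indices outside [q] have tilt 1, so the data enter only through the centred sum over [q]. *)
Lemma likelihood_shift_mean (e : R) (s : seq I) (z : U * (size s).-tuple R) :
  likelihood m (shift_mean e) z =
  expR (e * (\sum_(j < size s | q (tnth (in_tuple s) j))
               (tnth z.2 j - m (tnth (in_tuple s) j)))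
        - e ^+ 2 / 2 * (count q s)%:R).
Proof.
have -> : count q s = (\sum_(j < size s | q (tnth (in_tuple s) j)) 1)%N.
  by rewrite -sum1_count [in LHS](big_tnth _ _ s).
rewrite natr_sum !mulr_sumr -sumrB expR_sum big_mkcond /=.
apply: eq_bigr => j _; rewrite /tilt /shift_mean addrAC subrr add0r.
by case: ifP => _; rewrite ?mulr1// mul0r expr0n/= mul0r subr0 expR0.
Qed.

(** After a change of measure this is a pointwise inequality: with L1 and L2 the likelihood ratios
    for the raised and the lowered means, a low centred sum makes exp(-t) L2 at least 1, and
    otherwise L1 is not too small. *)
Lemma shift_mean_domination (P P1 P2 : probability T R) (s : seq I)
    (C : set (U * (size s).-tuple R)) (dlt tht t x : R) :
  (forall i (B : set R), measurable B -> P (X i @^-1` B) = gaussian (m i) B) ->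
  (forall i (B : set R), measurable B ->
     P1 (X i @^-1` B) = gaussian (shift_mean dlt i) B) ->
  (forall i (B : set R), measurable B ->
     P2 (X i @^-1` B) = gaussian (shift_mean (- tht) i) B) ->
  (forall B : set U, measurable B -> P (Z @^-1` B) = P1 (Z @^-1` B)) ->
  (forall B : set U, measurable B -> P (Z @^-1` B) = P2 (Z @^-1` B)) ->
  independent_off P X Z [::] -> independent_off P1 X Z [::] ->
  independent_off P2 X Z [::] ->
  uniq s -> measurable C -> 0 < dlt -> 0 < tht -> (count q s)%:R <= x ->
  (distribution P (observations X Z s) C <=
   (expR (dlt * t / tht + dlt * (dlt + tht) * x / 2))%:E *
     distribution P1 (observations X Z s) C +
   (expR (- t))%:E * distribution P2 (observations X Z s) C)%E.
Proof.
move=> lawX lawX1 lawX2 lawZ1 lawZ2 indP indP1 indP2 us mC dlt0 tht0 nx.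
set c := _ + _ * x / 2.
have mI : measurable_fun [set: U * (size s).-tuple R] (EFin \o (\1_C : _ -> R)).
  by apply/measurable_EFinP; exact: measurable_indic.
have I0 z : (0 <= (EFin \o (\1_C : _ -> R)) z :> \bar R)%E by rewrite lee_fin.
have cm := change_of_measure _ _ _ indP _ us mI I0.
have E (Q : probability T R) : distribution Q (observations X Z s) C =
    (\int[distribution Q (observations X Z s)]_z (EFin \o (\1_C : _ -> R)) z)%E.
  by rewrite integral_indic// setIT.
rewrite !E (cm _ _ _ lawX lawX1 lawZ1 indP1) (cm _ _ _ lawX lawX2 lawZ2 indP2).
have mL e := @measurable_likelihood R _ U I m (shift_mean e) s.
have mIL e : measurable_fun [set: U * (size s).-tuple R]
    (fun z => (EFin \o (\1_C : _ -> R)) z * (likelihood m (shift_mean e) z)%:E)%E.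
  by apply: emeasurable_funM => //; apply/measurable_EFinP; exact: mL.
have IL0 e z :
    (0 <= (EFin \o (\1_C : _ -> R)) z * (likelihood m (shift_mean e) z)%:E)%E.
  by rewrite mule_ge0// lee_fin likelihood_ge0.
rewrite -!ge0_integralZl_EFin ?expR_ge0//.
rewrite -ge0_integralD//; last 4 first.
- by move=> z _; rewrite mule_ge0// lee_fin expR_ge0.
- by apply: emeasurable_funM.
- by move=> z _; rewrite mule_ge0// lee_fin expR_ge0.
- by apply: emeasurable_funM.
apply: ge0_le_integral => //.
- by apply: emeasurable_funD; apply: emeasurable_funM.
move=> z _ /=; rewrite -!EFinM -EFinD lee_fin indicE.
case: (z \in C); rewrite ?(mul0r, mulr0, addr0)// !mul1r.
rewrite !likelihood_shift_mean -!expRD.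
set S := \sum_(_ < _ | _) _; set n := (count q s)%:R.
have n0 : 0 <= n by rewrite ler0n.
(* At this threshold the likelihood ratio for the lowered means equals exp(t). *)
have [St|St] := leP S (- t / tht - n * tht / 2).
  apply: ler_wpDl; first exact: expR_ge0.
  rewrite -[leLHS]expR0 ler_expR.
  move: St; rewrite -(ler_pM2l tht0).
  rewrite (_ : tht * (- t / tht - _) = - t - tht ^+ 2 / 2 * n).
    by rewrite sqrrN mulNr; set A := tht * S; set B := tht ^+ 2 / 2 * n; lra.
  by field; rewrite gt_eqF.
apply: ler_wpDr; first exact: expR_ge0.
rewrite -[leLHS]expR0 ler_expR.
have : dlt * (- t / tht - n * tht / 2) <= dlt * S by rewrite ler_pM2l// ltW.
have : 0 <= dlt * (dlt + tht) * (x - n).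
  by rewrite mulr_ge0 ?subr_ge0// mulr_ge0 ?addr_ge0// ltW.
rewrite /c !mulrBr; set w := dlt * t / tht.
rewrite (_ : dlt * (- t / tht) = - w); last by rewrite /w mulrA mulrN mulNr.
nra.
Qed.
End domination.

(** * Histories as functions of the sequence of arms *)

Section arm_sequences.
Context (R : realType) (K : nat) (d : measure_display) (U : measurableType d)
  (A : bandit_algorithm R K U) (k0 : 'I_K).

(* Entry [t] is the pair (arm, position in its stream) of the reward observed in
   round [t] by an algorithm whose successive choices are [a]. *)
Definition stream_indices (a : seq 'I_K) : seq ('I_K * nat) :=
  mkseq (fun t => (nth k0 a t, count_mem (nth k0 a t) (take t a))) (size a).

Lemma size_stream_indices (a : seq 'I_K) : size (stream_indices a) = size a.
Proof. by rewrite size_mkseq. Qed.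

(** The count of an arm strictly increases each time it is pulled. Distinctness is what
    [independent_off_observations] asks of the indices. *)
Lemma stream_indices_uniq (a : seq 'I_K) : uniq (stream_indices a).
Proof.
apply/mkseq_uniqP.
suff lt t t' : (t < t')%N -> (t' < size a)%N ->
    count_mem (nth k0 a t) (take t a) <> count_mem (nth k0 a t) (take t' a).
  move=> t t'; rewrite !inE => ta t'a [kk cc].
  have [tt|tt|//] := ltngtP t t'; first by have := lt _ _ tt t'a; rewrite cc kk.
  by have := lt _ _ tt ta; rewrite -cc kk.
move=> tt t'a; apply/eqP; rewrite ltn_eqF//.
rewrite -(subnKC tt) takeD count_cat (take_nth k0 (ltn_trans tt t'a)).
by rewrite -cats1 count_cat/= eqxx addn1 addSn ltnS leq_addr.
Qed.

Lemma count_stream_indices (a : seq 'I_K) (k : 'I_K) :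
  count (fun i => i.1 == k) (stream_indices a) = count_mem k a.
Proof.
by rewrite -(count_map fst (pred1 k)) -map_comp -[in RHS](mkseq_nth k0 a).
Qed.

Context (x : 'I_K -> nat -> R) (u : U).

Lemma size_history (n : nat) : size (history A x u n) = n.
Proof. by elim: n => //= n IHn; rewrite size_rcons IHn. Qed.

Lemma nth_arms_history (n t : nat) : (t < n)%N ->
  nth k0 (unzip1 (history A x u n)) t = choose_arm A u (history A x u t).
Proof.
elim: n => // n IHn; rewrite ltnS leq_eqVlt => tn /=.
rewrite /unzip1 map_rcons nth_rcons size_map size_history.
by case/orP: tn => [/eqP ->|tn]; rewrite ?ltnn ?eqxx// tn IHn.
Qed.

Lemma pulls_zip (a : seq 'I_K) (y : seq R) (k : 'I_K) :
  size a = size y -> pulls (zip a y) k = count_mem k a.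
Proof.
by move=> ay; rewrite /pulls -(count_map fst (pred1 k)) -/(unzip1 _) unzip1_zip ?ay.
Qed.

Lemma history_zip (a : seq 'I_K) (n : nat) :
  let y := [seq x i.1 i.2 | i <- stream_indices a] in
  (n <= size a)%N ->
  (forall t, (t < n)%N -> choose_arm A u (history A x u t) = nth k0 a t) ->
  history A x u n = zip (take n a) (take n y).
Proof.
move=> y; elim: n => [|n IHn] na ch; first by rewrite !take0.
have ya : size y = size a by rewrite size_map size_stream_indices.
have yn : nth 0 y n = x (nth k0 a n) (count_mem (nth k0 a n) (take n a)).
  by rewrite (nth_map (k0, 0%N)) ?size_stream_indices// nth_mkseq.
have tn : size (take n a) = size (take n y) by rewrite !size_take ya.
rewrite (take_nth k0 na) (take_nth 0) ?ya// zip_rcons// yn/=.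
have IH := IHn (ltnW na) (fun t tn => ch t (ltnW tn)).
by rewrite ch// IH pulls_zip.
Qed.

(** The right-hand side feeds the algorithm prefixes of [a] and of the fixed list [y] instead of its
    own history, so the event depends on the seed and these rewards alone. *)
Lemma arms_historyP (a : seq 'I_K) :
  let y := [seq x i.1 i.2 | i <- stream_indices a] in
  unzip1 (history A x u (size a)) = a <->
  (forall t, (t < size a)%N ->
     choose_arm A u (zip (take t a) (take t y)) = nth k0 a t).
Proof.
move=> y; have ya : size y = size a by rewrite size_map size_stream_indices.
split=> [ha|ch].
  have ch t : (t < size a)%N -> choose_arm A u (history A x u t) = nth k0 a t.
    by move=> ta; rewrite -[in RHS]ha nth_arms_history.
  move=> t ta; rewrite -history_zip ?ch// ?(ltnW ta)// => t' t't.
  exact/ch/(ltn_trans t't).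
(* Strong induction: the choice in round [t] only needs the history before [t] to be identified. *)
have hz n : (n <= size a)%N -> history A x u n = zip (take n a) (take n y).
  elim/ltn_ind: n => n IHn na; apply: history_zip => // t tn.
  by rewrite IHn ?ch ?(leq_trans tn)// (leq_trans (ltnW tn)).
rewrite hz// !take_oversize ?ya// unzip1_zip ?ya//.
Qed.

End arm_sequences.

(** * Expectations as finite sums over sequences of arms *)

Section arm_probabilities.
Context (R : realType) (K : nat) (M : bandit_model R K)
  (A : bandit_algorithm R K (seed_space M)) (k0 : 'I_K).

(** The length [n] is separate from [size a] because [arm_eventE] uses tuples of length
    [size (stream_indices k0 a)], which equals [size a] but not by computation. *)
Definition following (a : seq 'I_K) (n : nat) : set (seed_space M * n.-tuple R) :=
  [set z : seed_space M * n.-tuple R | forall t, (t < size a)%N ->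
     choose_arm A z.1 (zip (take t a) (take t z.2)) = nth k0 a t].

Lemma measurable_following (a : seq 'I_K) (n : nat) :
  size a = n -> measurable (@following a n).
Proof.
move=> an.
have -> : @following a n = \bigcap_(t in `I_n)
    [set z : seed_space M * n.-tuple R |
       choose_arm A z.1 (zip (take t a) (take t z.2)) = nth k0 a t].
  by apply/seteqP; split=> z /= zf t tn; apply: zf; rewrite /= ?an// -an.
apply: fin_bigcap_measurable; first exact: finite_II.
move=> t /= tn.
have ta : size (take t a) == t by rewrite size_takel// an ltnW.
(* Measurability of the algorithm is stated for exactly [t] past rewards, so the later ones are
   dropped. *)
pose p (z : seed_space M * n.-tuple R) : seed_space M * t.-tuple R :=
  (z.1, [tuple tnth z.2 (widen_ord (ltnW tn) j) | j < t]).
have mp : measurable_fun [set: seed_space M * n.-tuple R] p.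
  apply: measurable_fun_pair => //; apply/measurable_fun_tnthP => j.
  rewrite (_ : _ \o _ = fun z => tnth z.2 (widen_ord (ltnW tn) j)).
    exact: (measurableT_comp (measurable_tnth _)).
  by apply/funext => z /=; rewrite tnth_mktuple.
rewrite -[X in measurable X]setTI.
have := mp measurableT _ (choose_arm_measurable A (Tuple ta) (nth k0 a t)).
congr (measurable (_ `&` _)); apply/seteqP.
suff take_p (z : seed_space M * n.-tuple R) : (p z).2 = take t z.2 :> seq R.
  by split=> z /=; rewrite -take_p.
apply: (@eq_from_nth _ 0).
  by rewrite size_tuple size_takel// size_tuple ltnW.
move=> j; rewrite size_tuple => jt.
rewrite nth_take// -[j]/(val (Ordinal jt)) -tnth_nth tnth_mktuple.
by rewrite (tnth_nth 0).
Qed.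

Lemma independent_off_seed (mu : 'I_K -> R) :
  independent_off (law M mu) (fun i : 'I_K * nat => reward M i.1 i.2)
    (seed M) [::].
Proof.
move=> s B C us _ mB mC.
have := @reward_seed_independent _ _ M mu (None :: map Some s)
  (fun i => if i is Some i then reward M i.1 i.2 @^-1` B i else seed M @^-1` C).
rewrite set_mem_cons bigcap_setU1 big_cons big_map.
rewrite (_ : [set` map Some s] = Some @` [set` s]).
  rewrite bigcap_image; apply.
  - rewrite /= map_inj_uniq ?us ?andbT//.
    by apply/negP => /mapP[j _].
  - move=> [[k j]|] _; first by exists (B (k, j)) => //; rewrite setTI.
    by exists C => //; rewrite setTI.
apply/seteqP; split=> [i /= /mapP[j js ->]|_ /= [j js <-]]; first by exists j.
exact: map_f.
Qed.

Definition arm_event (a : seq 'I_K) : set (sample_space M) :=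
  [set w | unzip1 (history A (fun l j => reward M l j w) (seed M w) (size a))
           = a].

Lemma arm_eventE (a : seq 'I_K) :
  arm_event a =
  observations (fun i : 'I_K * nat => reward M i.1 i.2) (seed M)
    (stream_indices k0 a) @^-1` @following a _.
Proof.
apply/seteqP; split=> w /=; rewrite /arm_event /following/=.
  by move=> /arms_historyP wa t ta; rewrite valuesE; exact: wa.
by move=> wa; apply/(arms_historyP _ k0) => t ta; rewrite -wa// valuesE.
Qed.

Lemma measurable_arm_event (a : seq 'I_K) : measurable (arm_event a).
Proof.
rewrite arm_eventE -[X in measurable X]setTI.
apply: measurable_funPT => //; apply: measurable_following.
by rewrite size_stream_indices.
Qed.

Definition arm_prob (mu : 'I_K -> R) (a : seq 'I_K) : R :=
  fine (law M mu (arm_event a)).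

Lemma arm_probE (mu : 'I_K -> R) (a : seq 'I_K) :
  (arm_prob mu a)%:E = law M mu (arm_event a).
Proof. by rewrite fineK// fin_num_measure//; exact: measurable_arm_event. Qed.

Lemma arm_prob_ge0 (mu : 'I_K -> R) (a : seq 'I_K) : 0 <= arm_prob mu a.
Proof. by rewrite fine_ge0. Qed.

Definition shift_arm (mu : 'I_K -> R) (k : 'I_K) (e : R) (l : 'I_K) : R :=
  mu l + (if l == k then e else 0).

(** Here [q] selects the stream of arm [k], and [count_stream_indices] identifies the number of
    selected rewards with the number of pulls. *)
Lemma arm_prob_domination (mu : 'I_K -> R) (k : 'I_K) (a : seq 'I_K)
    (dlt tht t x : R) :
  0 < dlt -> 0 < tht -> (count_mem k a)%:R <= x ->
  arm_prob mu a <=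
    expR (dlt * t / tht + dlt * (dlt + tht) * x / 2) *
      arm_prob (shift_arm mu k dlt) a +
    expR (- t) * arm_prob (shift_arm mu k (- tht)) a.
Proof.
move=> dlt0 tht0 ax; rewrite -lee_fin EFinD !EFinM !arm_probE !arm_eventE.
have lawX (nu : 'I_K -> R) (i : 'I_K * nat) (B : set R) : measurable B ->
    law M nu (reward M i.1 i.2 @^-1` B) = gaussian (nu i.1) B.
  by move=> mB; rewrite -[LHS]/(distribution _ _ _) reward_law.
have lawZ (nu nu' : 'I_K -> R) (B : set (seed_space M)) : measurable B ->
    law M nu (seed M @^-1` B) = law M nu' (seed M @^-1` B).
  by move=> mB; exact: seed_law.
apply: (shift_mean_domination (m := fun i => mu i.1) (q := fun i => i.1 == k)) => //.
- by move=> i B mB; exact: lawX.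
- by move=> i B mB; exact: lawX.
- by move=> i B mB; exact: lawX.
- by move=> B mB; exact: lawZ.
- by move=> B mB; exact: lawZ.
- exact: independent_off_seed.
- exact: independent_off_seed.
- exact: independent_off_seed.
- exact: stream_indices_uniq.
- by apply: measurable_following; rewrite size_stream_indices.
- by rewrite count_stream_indices.
Qed.

(** The events of the tuples of length [N] partition the sample space, so exactly one term
    survives. *)
Lemma sum_arm_event (N : nat) (w : sample_space M) (g : seq 'I_K -> R) :
  \sum_(a : N.-tuple 'I_K) g a * \1_(arm_event a) w =
  g (unzip1 (history A (fun l j => reward M l j w) (seed M w) N)).
Proof.
set h := unzip1 _.
have hN : size h == N by rewrite size_map size_history.
rewrite (bigD1 (Tuple hN))//= big1 ?addr0 => [|a ah]; last first.
  rewrite indicE memNset ?mulr0// /arm_event/= size_tuple -/h => ha.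
  by case/eqP: ah; apply: val_inj.
by rewrite indicE mem_set ?mulr1// /arm_event/= (eqP hN).
Qed.

Lemma integral_arm_event (mu : 'I_K -> R) (N : nat) (g : seq 'I_K -> R) :
  (forall a, 0 <= g a) ->
  (\int[law M mu]_w (g (unzip1 (history A (fun l j => reward M l j w)
                                  (seed M w) N)))%:E =
   (\sum_(a : N.-tuple 'I_K) g a * arm_prob mu a)%:E)%E.
Proof.
move=> g0.
under eq_integral do rewrite -sum_arm_event -sumEFin.
have mI (a : seq 'I_K) :
    measurable_fun [set: sample_space M] (EFin \o (\1_(arm_event a) : _ -> R)).
  by apply/measurable_EFinP; apply: measurable_indic; exact: measurable_arm_event.
rewrite ge0_integral_sum//=; last 2 first.
- move=> a; under eq_fun do rewrite EFinM.
  by apply: emeasurable_funM => //; exact: mI.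
- by move=> a w _; rewrite lee_fin mulr_ge0.
rewrite -sumEFin; apply: eq_bigr => a _.
under eq_integral do rewrite EFinM.
rewrite ge0_integralZl_EFin//; last exact: mI.
rewrite integral_indic ?setIT//; last exact: measurable_arm_event.
by rewrite EFinM arm_probE.
Qed.

Lemma sum_arm_prob (mu : 'I_K -> R) (N : nat) :
  \sum_(a : N.-tuple 'I_K) arm_prob mu a = 1.
Proof.
apply: EFin_inj; have := @integral_arm_event mu N (fun=> 1) (fun=> ler01).
rewrite integral_cst// mul1e => sumE.
apply: etrans (etrans (esym sumE) (probability_setT (law M mu))).
by congr EFin; apply: eq_bigr => a _; rewrite mul1r.
Qed.

Lemma expectation_arm_count (mu : 'I_K -> R) (N : nat) (k : 'I_K) :
  ('E_(law M mu)[fun w => (arm_count A N k w)%:R])%E =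
  (\sum_(a : N.-tuple 'I_K) (count_mem k a)%:R * arm_prob mu a)%:E.
Proof.
rewrite -(@integral_arm_event mu N (fun a => (count_mem k a)%:R))//.
rewrite unlock; apply: eq_integral => w _; congr (_%:R%:E).
by rewrite /arm_count /pulls count_map.
Qed.

End arm_probabilities.

(** * Bounds on the number of pulls of one arm *)

Section mean_pulls.
Context (R : realType) (K : nat) (M : bandit_model R K)
  (A : bandit_algorithm R K (seed_space M)) (N : nat).

Definition mean_pulls (mu : 'I_K -> R) (k : 'I_K) : R :=
  \sum_(a : N.-tuple 'I_K) (count_mem k a)%:R * arm_prob A mu a.

Definition few_pulls_prob (mu : 'I_K -> R) (k : 'I_K) (x : R) : R :=
  \sum_(a : N.-tuple 'I_K | (count_mem k a)%:R <= x) arm_prob A mu a.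

Lemma mean_pulls_ge0 (mu : 'I_K -> R) (k : 'I_K) : 0 <= mean_pulls mu k.
Proof. by apply: sumr_ge0 => a _; rewrite mulr_ge0// arm_prob_ge0. Qed.

Lemma regretE (mu : 'I_K -> R) :
  regret A N mu = (\sum_(k < K) (best_mean mu - mu k) * mean_pulls mu k)%:E.
Proof.
rewrite /regret -sumEFin; apply: eq_bigr => k _.
by rewrite expectation_arm_count// EFinM.
Qed.

Lemma few_pulls_prob_le1 (mu : 'I_K -> R) (k : 'I_K) (x : R) :
  few_pulls_prob mu k x <= 1.
Proof.
rewrite -(sum_arm_prob A k mu N) /few_pulls_prob.
rewrite [leRHS](bigID (fun a : N.-tuple 'I_K => (count_mem k a)%:R <= x))/=.
by rewrite lerDl sumr_ge0// => a _; exact: arm_prob_ge0.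
Qed.

(** Markov's inequality. *)
Lemma mean_pulls_ge (mu : 'I_K -> R) (k : 'I_K) (x : R) :
  0 <= x -> x * (1 - few_pulls_prob mu k x) <= mean_pulls mu k.
Proof.
move=> x0; rewrite -(sum_arm_prob A k mu N) /few_pulls_prob /mean_pulls.
rewrite (bigID (fun a : N.-tuple 'I_K => (count_mem k a)%:R <= x))/=.
rewrite addrAC subrr add0r mulr_sumr.
rewrite [leRHS](bigID (fun a : N.-tuple 'I_K => (count_mem k a)%:R <= x))/=.
apply: ler_wpDl.
  by apply: sumr_ge0 => a _; rewrite mulr_ge0// arm_prob_ge0.
apply: ler_sum => a; rewrite -ltNge => /ltW xa.
by rewrite ler_wpM2r// arm_prob_ge0.
Qed.

(** Summation of [arm_prob_domination] over sequences; the lowered law enters only through a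
    probability, at most 1. *)
Lemma few_pulls_prob_domination (mu : 'I_K -> R) (k : 'I_K)
    (dlt tht t x : R) : 0 < dlt -> 0 < tht ->
  few_pulls_prob mu k x <=
    expR (dlt * t / tht + dlt * (dlt + tht) * x / 2) *
      few_pulls_prob (shift_arm mu k dlt) k x + expR (- t).
Proof.
move=> dlt0 tht0; apply: (@le_trans _ _
  (expR (dlt * t / tht + dlt * (dlt + tht) * x / 2) *
     few_pulls_prob (shift_arm mu k dlt) k x +
   expR (- t) * few_pulls_prob (shift_arm mu k (- tht)) k x)).
  rewrite !mulr_sumr -big_split/=; apply: ler_sum => a ax.
  exact: arm_prob_domination.
by rewrite lerD2l ler_piMr ?expR_ge0// few_pulls_prob_le1.
Qed.

Lemma sum_count_mem_tuple (a : N.-tuple 'I_K) :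
  (\sum_(l < K) count_mem l a)%N = N.
Proof.
rewrite -[RHS](size_tuple a) -sum1_size [RHS](partition_big id xpredT)//=.
by apply: eq_bigr => l _; rewrite sum1_count.
Qed.

(** If [k] is pulled at most [x] times, the other arms share at least [N - x] pulls, each costing at
    least [g]. *)
Lemma few_pulls_prob_le (mu : 'I_K -> R) (k : 'I_K) (g x : R) :
  0 <= g -> (forall l, mu l <= best_mean mu) ->
  (forall l, l != k -> g <= best_mean mu - mu l) ->
  ((g * (N%:R - x) * few_pulls_prob mu k x)%:E <= regret A N mu)%E.
Proof.
move=> g0 mub gl; rewrite regretE lee_fin.
apply: (@le_trans _ _ (\sum_(l < K | l != k) g * mean_pulls mu l)); last first.
  rewrite [leRHS](bigD1 k)//=; apply: ler_wpDl.
    by rewrite mulr_ge0 ?mean_pulls_ge0// subr_ge0.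
  by apply: ler_sum => l lk; rewrite ler_wpM2r ?mean_pulls_ge0// gl.
rewrite -mulr_sumr -mulrA ler_wpM2l// /mean_pulls exchange_big/=.
rewrite mulr_sumr.
rewrite [leRHS](bigID (fun a : N.-tuple 'I_K => (count_mem k a)%:R <= x))/=.
apply: ler_wpDr.
  apply: sumr_ge0 => a _; apply: sumr_ge0 => l _.
  by rewrite mulr_ge0// arm_prob_ge0.
apply: ler_sum => a ax; rewrite -mulr_suml ler_wpM2r ?arm_prob_ge0//.
rewrite -{1}(sum_count_mem_tuple a) (bigD1 k)//= natrD natr_sum.
by rewrite lerBlDr addrC lerD2l.
Qed.

End mean_pulls.

(** * Promoting a suboptimal arm *)

Lemma best_meanP (R : realType) (K : nat) (mu : 'I_K -> R) (k0 : 'I_K) :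
  exists k, best_mean mu = mu k /\ forall l, mu l <= mu k.
Proof.
have [k _ kmax] := @Order.TotalTheory.arg_maxP _ _ _ k0 xpredT mu isT.
exists k; split=> [|l]; last exact: kmax.
apply/eqP; rewrite eq_le; apply/andP; split.
  by apply: ge_sup => [|_ [l _ <-]]; [exists (mu k); exists k|exact: kmax].
by apply: ub_le_sup; [exists (mu k) => _ [l _ <-]; exact: kmax|exists k].
Qed.

Lemma le_best_mean (R : realType) (K : nat) (mu : 'I_K -> R) (k : 'I_K) :
  mu k <= best_mean mu.
Proof. by have [l [-> ]] := best_meanP mu k. Qed.

Lemma best_mean_eq (R : realType) (K : nat) (mu : 'I_K -> R) (k : 'I_K) :
  (forall l, mu l <= mu k) -> best_mean mu = mu k.
Proof.
move=> kmax; have [l [-> lmax]] := best_meanP mu k.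
by apply/eqP; rewrite eq_le kmax lmax.
Qed.

(* The factor 1 / (1 + D^2) keeps this below 1/2 and makes its inverse at least
   1 / D + eta D, which bounds the means once one of them has been raised. *)
Definition shifted_gap (R : realType) (eta D : R) : R := eta * D / (1 + D ^+ 2).

Lemma shift_arm_other (R : realType) (K : nat) (mu : 'I_K -> R) (k l : 'I_K)
    (e : R) :
  l != k -> shift_arm mu k e l = mu l.
Proof. by rewrite /shift_arm => /negbTE ->; rewrite addr0. Qed.

Lemma shift_arm_promoted (R : realType) (K : nat) (mu : 'I_K -> R) (k : 'I_K)
    (b e : R) :
  shift_arm mu k (b - mu k + e) k = b + e.
Proof. by rewrite /shift_arm eqxx; ring. Qed.

Lemma best_mean_promoted (R : realType) (K : nat) (mu : 'I_K -> R)
    (k : 'I_K) (e : R) :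
  0 < e ->
  best_mean (shift_arm mu k (best_mean mu - mu k + e)) = best_mean mu + e.
Proof.
move=> e0; rewrite -(shift_arm_promoted mu k (best_mean mu) e); apply: best_mean_eq => l.
have [->//|lk] := eqVneq l k.
by rewrite shift_arm_promoted shift_arm_other// ler_wpDr ?le_best_mean// ltW.
Qed.

Lemma promoted_gap (R : realType) (K : nat) (mu : 'I_K -> R) (k l : 'I_K)
    (e : R) (mu' := shift_arm mu k (best_mean mu - mu k + e)) :
  0 < e -> l != k -> e <= best_mean mu' - mu' l.
Proof.
move=> e0 lk; rewrite best_mean_promoted// /mu' shift_arm_other//.
by rewrite addrAC lerDr subr_ge0 le_best_mean.
Qed.

(** The promoted arm is the unique best one, so the other [K - 1] arms, at least half of all, are
    suboptimal, while [shifted_gap eta D] is at most 1/2. *)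
Lemma Theta_promoted (R : realType) (K : nat) (mu : 'I_K -> R) (k : 'I_K)
    (eta D : R) :
  0 < eta -> eta <= 2^-1 -> 0 < D -> Theta D mu -> mu k < best_mean mu ->
  Theta (shifted_gap eta D)
    (shift_arm mu k (best_mean mu - mu k + eta * D)).
Proof.
move=> eta0 eta1 D0 [_ muD _] subk; set mu' := shift_arm _ _ _.
have etaD0 : 0 < eta * D by rewrite mulr_gt0.
have mu'k : mu' k = best_mean mu + eta * D by rewrite /mu' shift_arm_promoted.
have bestE : best_mean mu' = mu' k by rewrite /mu' best_mean_promoted.
have D21 : 0 < 1 + D ^+ 2 by rewrite ltr_pwDl// sqr_ge0.
have gapD : shifted_gap eta D <= eta * D.
  by rewrite ler_pdivrMr// ler_peMr ?lerDl ?sqr_ge0// ltW.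
have invD : D^-1 + eta * D <= (shifted_gap eta D)^-1.
  have -> : (shifted_gap eta D)^-1 = eta^-1 * (D^-1 + D).
    by rewrite /shifted_gap; field; rewrite !gt_eqF.
  have e1 : 1 <= eta^-1 by rewrite invf_ge1//; lra.
  rewrite mulrDr lerD//; first by rewrite ler_peMl// invr_ge0 ltW.
  by rewrite ler_wpM2r ?(ltW D0)//; lra.
have gap_half : shifted_gap eta D <= 2^-1.
  rewrite ler_pdivrMr//; have := sqr_ge0 (1 - D); nra.
have [b [bE _]] := best_meanP mu k.
have bk : b != k by apply: contraTneq subk => <-; rewrite bE ltxx.
split.
- move=> l; have [->|lk] := eqVneq l k; first by rewrite bestE ltxx.
  by move=> _; have := promoted_gap mu etaD0 lk; rewrite -/mu'; lra.
- move=> l; apply: le_trans invD; have [->|lk] := eqVneq l k.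
    rewrite mu'k (le_trans (ler_normD _ _))// (gtr0_norm etaD0) lerD2r.
    by rewrite bE.
  by rewrite /mu' shift_arm_other// ler_wpDr// ltW.
- have -> : num_suboptimal mu' = K.-1.
    rewrite -[in RHS](card_ord K) -(cardC1 k); apply: eq_card => l.
    rewrite !inE; have [->|lk] := eqVneq l k; first by rewrite bestE ltxx.
    by have := promoted_gap mu etaD0 lk; rewrite -subr_gt0; apply: lt_le_trans.
  (* An arm attaining the old maximum differs from [k]; two arms suffice for [K - 1] to be at least
     [K / 2]. *)
  have K2 : (2 <= K)%N.
    move: bk; rewrite -(inj_eq val_inj) /=.
    by have := ltn_ord b; have := ltn_ord k; lia.
  apply: (@le_trans _ _ (2^-1 * K%:R)); first by rewrite ler_wpM2r.
  have KE : K%:R = K.-1%:R + 1 :> R by rewrite natr1 (ltn_predK K2).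
  have : 1 <= K.-1%:R :> R by rewrite ler1n -ltnS (ltn_predK K2).
  by rewrite KE; lra.
Qed.

(** * Lower bounds at a fixed horizon *)

(** [L] stands for log N, [c] for an exponent just below 1 - zeta, and [B] for the regret bound that
    uniform goodness supplies. The inequality on [B] makes few pulls of [k] unlikely under the
    promoted means, even after the cost of returning to [mu]. *)
Lemma mean_pulls_lower_bound (R : realType) (K : nat) (M : bandit_model R K)
    (A : bandit_algorithm R K (seed_space M)) (N : nat) (mu : 'I_K -> R)
    (k : 'I_K) (D eta L c B : R) :
  0 < D -> 0 < eta -> eta <= 2^-1 -> 0 <= L -> 0 <= c -> c <= 1 ->
  (0 < N)%N -> 4 * L <= D ^+ 2 * N%:R ->
  (forall nu, Theta (shifted_gap eta D) nu -> (regret A N nu <= B%:E)%E) ->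
  expR (- ln eta / eta) * expR (c * L) * B <= eta * (eta * D * N%:R / 2) ->
  Theta D mu -> mu k < best_mean mu ->
  c * (1 - 2 * eta) / (1 + eta) ^+ 3 *
    (2 / (best_mean mu - mu k) * L) <=
  (best_mean mu - mu k) * mean_pulls A N mu k.
Proof.
move=> D0 eta0 eta1 L0 c0 c1 N0 LD regB small Dmu subk.
set g := best_mean mu - mu k.
have g0 : 0 < g by rewrite subr_gt0.
have Dg : D <= g by have [gap _ _] := Dmu; have := gap k subk; rewrite /g; lra.
(* Chosen so that the exponent [dlt * (dlt + tht) * x / 2] is at most [c * L]: [tht = eta * dlt]
   costs one factor [1 + eta], and [dlt <= (1 + eta) * g] two more. *)
pose x := 2 * c * L / ((1 + eta) ^+ 3 * g ^+ 2).
have e30 : 0 < (1 + eta) ^+ 3 by rewrite exprn_gt0// addr_gt0.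
have g20 : 0 < g ^+ 2 by rewrite exprn_gt0.
have x0 : 0 <= x.
  apply: divr_ge0; first by rewrite !mulr_ge0.
  by apply: mulr_ge0; exact: ltW.
have NR0 : 0 < N%:R :> R by rewrite ltr0n.
have e31 : 1 <= (1 + eta) ^+ 3 by rewrite exprn_ege1// lerDl ltW.
have DgN : D ^+ 2 * N%:R <= g ^+ 2 * N%:R.
  by rewrite ler_wpM2r// lerXn2r// nnegrE ltW.
(* At least N/2 pulls are then left for the other arms. *)
have xN : x <= N%:R / 2.
  rewrite ler_pdivrMr; last exact: mulr_gt0.
  have : 2 * c * L <= 2 * L by nra.
  have : g ^+ 2 * N%:R <= N%:R / 2 * ((1 + eta) ^+ 3 * g ^+ 2) * 2 by nra.
  by lra.
pose dlt := g + eta * D.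
have dlt0 : 0 < dlt by rewrite addr_gt0// mulr_gt0.
pose mu' := shift_arm mu k dlt.
have etaD0 : 0 < eta * D by exact: mulr_gt0.
have few : few_pulls_prob A N mu k x <= 2 * eta.
  (* With t = -ln eta, exp(-t) is [eta]; lowering by [eta * dlt] turns [dlt * t / tht] into
     [- ln eta / eta], whatever the gap. *)
  have := few_pulls_prob_domination A N mu k (- ln eta) x dlt0 (mulr_gt0 eta0 dlt0).
  rewrite opprK lnK ?posrE// -/mu' => /le_trans; apply.
  rewrite (_ : 2 * eta = eta + eta); last by ring.
  rewrite lerD2r.
  set P' := few_pulls_prob A N mu' k x.
  have P'0 : 0 <= P' by apply: sumr_ge0 => a _; exact: arm_prob_ge0.
  (* Under [mu'] every pull of another arm costs at least [eta * D]. *)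
  have P'B : eta * D * N%:R / 2 * P' <= B.
    rewrite -lee_fin; apply: le_trans (regB _ (Theta_promoted eta0 eta1 D0 Dmu subk)).
    apply: le_trans (few_pulls_prob_le A N x (ltW etaD0) (le_best_mean mu')
      (fun l => @promoted_gap _ _ mu k l _ etaD0)).
    by rewrite lee_fin ler_wpM2r// -mulrA ler_wpM2l ?(ltW etaD0)//; lra.
  rewrite -(ler_pM2r (_ : 0 < eta * D * N%:R / 2)) ?divr_gt0 ?mulr_gt0//.
  apply: le_trans small; rewrite -(mulrA _ P') (mulrC P').
  apply: ler_pM => //; first by rewrite mulr_ge0// divr_ge0// ?mulr_ge0// ltW.
  rewrite -expRD ler_expR lerD//.
    by rewrite le_eqVlt; apply/orP; left; apply/eqP; field; rewrite !gt_eqF.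
  have dltg : dlt <= (1 + eta) * g by rewrite mulrDl mul1r lerD2l ler_wpM2l// ltW.
  have dlt2 : dlt ^+ 2 <= (1 + eta) ^+ 2 * g ^+ 2.
    rewrite -exprMn lerXn2r// nnegrE; first exact: ltW.
    by rewrite mulr_ge0 ?ltW// addr_gt0.
  have -> : c * L = (1 + eta) ^+ 3 * g ^+ 2 * x / 2.
    by rewrite /x; field; rewrite !gt_eqF// addr_gt0.
  have -> : dlt * (dlt + eta * dlt) = (1 + eta) * dlt ^+ 2 by ring.
  rewrite ler_wpM2r// ler_wpM2r// [(1 + eta) ^+ 3]exprS -mulrA ler_wpM2l//.
  by rewrite ltW// addr_gt0.
have -> : c * (1 - 2 * eta) / (1 + eta) ^+ 3 * (2 / g * L) =
    g * (x * (1 - 2 * eta)).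
  by rewrite /x; field; rewrite !gt_eqF// addr_gt0.
rewrite ler_wpM2l ?(ltW g0)//; apply: le_trans (mean_pulls_ge A N mu k x0).
by rewrite ler_wpM2l// lerD2l lerN2.
Qed.

Lemma regret_lower_bound (R : realType) (K : nat) (M : bandit_model R K)
    (A : bandit_algorithm R K (seed_space M)) (N : nat) (mu : 'I_K -> R)
    (D eta L c B : R) :
  0 < D -> 0 < eta -> eta <= 2^-1 -> 0 <= L -> 0 <= c -> c <= 1 ->
  (0 < N)%N -> 4 * L <= D ^+ 2 * N%:R ->
  (forall nu, Theta (shifted_gap eta D) nu -> (regret A N nu <= B%:E)%E) ->
  expR (- ln eta / eta) * expR (c * L) * B <= eta * (eta * D * N%:R / 2) ->
  Theta D mu ->
  ((c * (1 - 2 * eta) / (1 + eta) ^+ 3 * (complexity mu * L))%:E <=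
   regret A N mu)%E.
Proof.
move=> D0 eta0 eta1 L0 c0 c1 N0 LD regB small Dmu.
rewrite regretE lee_fin /complexity mulr_suml mulr_sumr.
rewrite [leRHS](bigID (fun k => mu k < best_mean mu))/=.
apply: ler_wpDr.
  apply: sumr_ge0 => k _; rewrite mulr_ge0 ?mean_pulls_ge0// subr_ge0.
  exact: le_best_mean.
apply: ler_sum => k subk; exact: mean_pulls_lower_bound regB _ _ _.
Qed.

(** * Asymptotics of [K], [Delta] and the regret *)

Lemma limn_einf_ge (R : realType) (u : nat -> \bar R) (l : \bar R) :
  (\forall n \near \oo, (l <= u n)%E) -> (l <= limn_einf u)%E.
Proof.
move=> ul; rewrite limn_einf_lim; apply: lime_ge; first exact: is_cvg_einfs.
case: ul => n0 _ ul; exists n0 => // n n0n.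
by apply: le_ereal_inf_tmp => _ [m /= nm <-]; apply: ul; exact: leq_trans nm.
Qed.

Lemma near_le_ln (R : realType) (C : R) : \forall N \near \oo, C <= ln (N%:R : R).
Proof.
near=> N; have CN : expR C <= N%:R by near: N; exact: nbhs_infty_ger.
by rewrite -[leLHS]expRK ler_ln// posrE ?expR_gt0// (lt_le_trans (expR_gt0 C)).
Unshelve. all: by end_near. Qed.

Lemma arms_growth_le (R : realType) (K : nat -> nat) (zeta eps : R) :
  (forall N, (0 < K N)%N) -> arms_growth K zeta -> 0 < eps ->
  \forall N \near \oo, (K N)%:R <= expR ((zeta + eps) * ln N%:R).
Proof.
move=> K0 [[_ _ _ [e [e0 KE]]]|[-> [k0 KE]]] eps0.
  near=> N; have N0 : (N%:R : R) != 0.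
    by rewrite pnatr_eq0 -lt0n; near: N; exact: nbhs_infty_gt.
  have -> : (K N)%:R = (N%:R : R) `^ (zeta + e N) by near: N.
  rewrite /powR (negbTE N0) ler_expR ler_wpM2r//.
    by near: N; exact: near_le_ln.
  by rewrite lerD2l ltW//; near: N; exact: cvgr_lt eps0.
near=> N; rewrite KE add0r -[leLHS]lnK ?posrE; last first.
  by rewrite ltr0n -(KE 0).
rewrite ler_expR mulrC -ler_pdivrMr//; near: N; exact: near_le_ln.
Unshelve. all: by end_near. Qed.

Lemma near_arms (R : realType) (K : nat -> nat) (Q : nat -> Prop) :
  (K N)%:R @[N --> \oo] --> (+oo : set_system R) ->
  (\forall n \near \oo, Q n) -> \forall N \near \oo, Q (K N).
Proof.
move=> /cvgryPge Koo [n0 _ Qn]; near=> N; apply: Qn => /=.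
by rewrite -(ler_nat R); near: N; exact: Koo.
Unshelve. all: by end_near. Qed.

(** If [K] grows, it is eventually at most N^2, so K^(eps/2) is at most N^eps, and its product with
    [Delta] is eventually at least 1. If [K] is fixed, [Delta (K N)] is a positive constant. *)
Lemma subpolynomial_ge (R : realType) (K : nat -> nat) (zeta eps : R)
    (Delta : nat -> R) :
  (forall N, (0 < K N)%N) -> arms_growth K zeta -> subpolynomial Delta ->
  0 < eps ->
  \forall N \near \oo, expR (- eps * ln N%:R) <= Delta (K N).
Proof.
move=> K0 hK [D0 _ Doo] eps0; case: (hK) => [[zeta0 zeta1 Koo _]|[_ [k0 KE]]].
  have e20 : 0 < eps / 2 by rewrite divr_gt0.
  have /cvgryPge/(_ 1) Doo1 := Doo _ e20.
  have DK := near_arms Koo Doo1.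
  have KN := arms_growth_le K0 hK ltr01.
  have L0 := @near_le_ln R 0; apply: filterS3 KN L0 DK => N KN L0 DK.
  have D0K := D0 _ (K0 N).
  have : (K N)%:R `^ (eps / 2) <= expR (eps * ln N%:R).
    rewrite /powR pnatr_eq0 gtn_eqF// ler_expR.
    have : ln (K N)%:R <= (zeta + 1) * ln N%:R.
      by rewrite -[leRHS]expRK ler_ln// posrE ?expR_gt0// ltr0n.
    move=> KL; have z2 : (zeta + 1) * ln N%:R <= 2 * ln N%:R.
      by rewrite ler_wpM2r//; lra.
    have -> : eps * ln N%:R = eps / 2 * (2 * ln N%:R) by field.
    by rewrite ler_wpM2l ?(ltW e20)// (le_trans KL z2).
  move=> KL; rewrite mulNr expRN -[_^-1]div1r ler_pdivrMr ?expR_gt0//.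
  by apply: le_trans DK _; rewrite ler_wpM2l// ltW.
have Dk0 : 0 < Delta k0 by apply: D0; rewrite -(KE 0).
near=> N; rewrite KE -[leRHS]lnK ?posrE// ler_expR mulNr lerNl mulrC.
by rewrite -ler_pdivrMr//; near: N; exact: near_le_ln.
Unshelve. all: by end_near. Qed.

(** The new sequence is at most [eta * Delta], and at least half of that once |Delta| < 1. *)
Lemma subpolynomial_shifted_gap (R : realType) (eta : R) (Delta : nat -> R) :
  0 < eta -> subpolynomial Delta ->
  subpolynomial (fun K => shifted_gap eta (Delta K)).
Proof.
move=> eta0 [D0 Dto0 Doo].
have S0 (x : R) : 0 < 1 + x ^+ 2 by rewrite ltr_pwDl// sqr_ge0.
split=> [K K0|| eps eps0].
- by rewrite divr_gt0 ?mulr_gt0 ?D0.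
- apply: (@squeeze_cvgr _ _ _ _ (fun=> 0) (fun K => eta * Delta K)).
  + near=> K; have K0 : (0 < K)%N by near: K; exact: nbhs_infty_gt.
    have etaD : 0 < eta * Delta K by rewrite mulr_gt0 ?D0.
    rewrite /shifted_gap divr_ge0 ?(ltW etaD) ?(ltW (S0 _))//=.
    by rewrite ler_pdivrMr// ler_peMr ?(ltW etaD)// lerDl sqr_ge0.
  + exact: cvg_cst.
  + by rewrite -[X in _ --> X](mulr0 eta); apply: cvgMr.
- apply/cvgryPge => C.
  have D1 : \forall K \near \oo, `|Delta K| < 1.
    by apply: cvgr_norm_lt Dto0 _ _; rewrite normr0.
  have /cvgryPge/(_ (2 * `|C| / eta)) DC := Doo _ eps0.
  apply: filterS2 D1 DC => K D1; rewrite ler_pdivrMr//.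
  set P := _ `^ _ => DC; rewrite /shifted_gap mulrAC ler_pdivlMr//.
  have P0 : 0 <= P by exact: powR_ge0.
  have D21 : Delta K ^+ 2 <= 1.
    by rewrite -[leLHS]real_normK ?num_real// exprn_ile1// ltW.
  have CD : C * (1 + Delta K ^+ 2) <= `|C| * 2.
    apply: (@le_trans _ _ (`|C| * (1 + Delta K ^+ 2))).
      by rewrite ler_wpM2r ?ler_norm// ltW.
    by rewrite ler_wpM2l//; lra.
  by apply: le_trans CD _; rewrite mulrC; apply: le_trans DC _; rewrite mulrC mulrA.
Unshelve. all: by end_near. Qed.

(** A ratio tending to 0 is eventually below 1; the bound is uniform in [mu] because [worst_regret]
    dominates a supremum. *)
Lemma uniformly_good_le (R : realType) (K : nat -> nat)
    (M : forall N, bandit_model R (K N))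
    (A : forall N, bandit_algorithm R (K N) (seed_space (M N)))
    (Delta : nat -> R) (eps : R) :
  (forall N, (0 < K N)%N) ->
  uniformly_good A -> subpolynomial Delta -> 0 < eps ->
  \forall N \near \oo, forall mu, Theta (Delta (K N)) mu ->
    (regret (A N) N mu <= ((K N)%:R * expR (eps * ln N%:R))%:E)%E.
Proof.
move=> K0 hA hD eps0; have /fine_cvgP[fW W1] := hA _ hD _ eps0.
have {}W1 : \forall N \near \oo, fine (worst_regret (A N) N (Delta (K N)) /
    ((K N)%:R * N%:R `^ eps)%:E)%E < 1.
  exact: (cvgr_lt _ W1 _ ltr01).
have Npos := nbhs_infty_gt 0.
apply: filterS3 fW W1 Npos => N fW W1 N0 mu Dmu.
have c0 : 0 < (K N)%:R * (N%:R : R) `^ eps.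
  by rewrite mulr_gt0 ?ltr0n ?powR_gt0 ?ltr0n.
have : (worst_regret (A N) N (Delta (K N)) /
        ((K N)%:R * N%:R `^ eps)%:E <= 1)%E.
  by rewrite -[leLHS]fineK// lee_fin ltW.
rewrite inver gt_eqF// lee_pdivrMr// mul1e /powR pnatr_eq0 gtn_eqF//.
apply: le_trans; rewrite /worst_regret le_max; apply/orP; right.
by apply: ereal_sup_ubound; exists mu.
Qed.

(** The lower bound on [num_suboptimal] in [Theta] forces a suboptimal arm, so the divisor in the
    theorem is positive. *)
Lemma complexity_gt0 (R : realType) (K : nat) (D : R) (mu : 'I_K -> R) :
  (0 < K)%N -> 0 < D -> Theta D mu -> 0 < complexity mu.
Proof.
move=> K0 D0 [_ _ J].
have /card_gt0P[k] : (0 < num_suboptimal mu)%N.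
  by rewrite -(ltr_nat R) (lt_le_trans _ J)// mulr_gt0// ltr0n.
rewrite inE => subk; rewrite /complexity (bigD1 k)//= ltr_wpDr//.
  by apply: sumr_ge0 => l /andP[subl _]; rewrite divr_ge0// subr_ge0 ltW.
by rewrite divr_gt0// subr_gt0.
Qed.

(** * Choice of the constants and conclusion *)

(** (1 - 2 eta) / (1 + eta)^3 is at least 1 - 5 eta, and (1 - zeta - eta) (1 - 5 eta) is at least 1
    - zeta - 6 eta. *)
Lemma lower_factor (R : realType) (zeta eta : R) :
  0 <= zeta -> 0 < eta -> eta <= 2^-1 -> zeta + eta <= 1 ->
  1 - zeta - 6 * eta <= (1 - zeta - eta) * (1 - 2 * eta) / (1 + eta) ^+ 3.
Proof.
move=> zeta0 eta0 eta1 zeta_eta.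
rewrite ler_pdivlMr ?exprn_gt0 ?addr_gt0//.
have E : (1 - 5 * eta) * (1 + eta) ^+ 3 <= 1 - 2 * eta.
  rewrite -subr_ge0 (_ : _ - _ = eta ^+ 2 * (12 + 14 * eta + 5 * eta ^+ 2)).
    by rewrite mulr_ge0 ?sqr_ge0// !addr_ge0// mulr_ge0 ?sqr_ge0// ltW.
  by ring.
apply: (@le_trans _ _ ((1 - zeta - eta) * ((1 - 5 * eta) * (1 + eta) ^+ 3))).
  rewrite mulrA ler_wpM2r ?exprn_ge0 ?addr_ge0 ?(ltW eta0)//.
  have : 0 <= eta * (zeta + eta).
    by rewrite mulr_ge0 ?(ltW eta0)// addr_ge0 ?(ltW eta0).
  by nra.
by rewrite ler_wpM2l//; lra.
Qed.

(** Once [KN] and [D] are replaced by their bounds, the exponents are (1 - 6 eta / 8) L on the left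
    and (1 - eta / 8) L on the right, up to constants. The lower bound on [L] lets the margin 5 eta
    L / 8 absorb these constants. *)
Lemma eta_exponent_bound (R : realType) (zeta eta L KN D : R) :
  0 < eta -> 0 <= KN ->
  8 * (- ln eta / eta - ln (eta ^+ 2 / 2)) / (5 * eta) <= L ->
  KN <= expR ((zeta + eta / 8) * L) -> expR (- (eta / 8) * L) <= D ->
  expR (- ln eta / eta) * expR ((1 - zeta - eta) * L) *
    (KN * expR (eta / 8 * L)) <= eta * (eta * D * expR L / 2).
Proof.
move=> eta0 KN0 CL KNL DL.
have e20 : 0 < eta ^+ 2 / 2 by rewrite divr_gt0 ?exprn_gt0.
apply: (@le_trans _ _ (expR (- ln eta / eta) * expR ((1 - zeta - eta) * L) *
    (expR ((zeta + eta / 8) * L) * expR (eta / 8 * L)))).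
  by rewrite ler_wpM2l ?mulr_ge0 ?expR_ge0// ler_wpM2r ?expR_ge0.
apply: (@le_trans _ _ (eta ^+ 2 / 2 * (expR (- (eta / 8) * L) * expR L))).
  rewrite -[eta ^+ 2 / 2]lnK ?posrE// -!expRD ler_expR.
  move: CL; rewrite ler_pdivrMr ?mulr_gt0//.
  set p := - ln eta / eta; set q := ln _; move=> CL.
  have -> : p + (1 - zeta - eta) * L + ((zeta + eta / 8) * L + eta / 8 * L) =
    p + L - (6 * eta * L) / 8 by field.
  have -> : q + (- (eta / 8) * L + L) = q + L - (eta * L) / 8 by field.
  have -> : 6 * eta * L = 5 * eta * L + eta * L by ring.
  have : L * (5 * eta) = 5 * eta * L by ring.
  lra.
have -> : eta * (eta * D * expR L / 2) = eta ^+ 2 / 2 * (D * expR L) by field.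
by rewrite ler_wpM2l ?(ltW e20)// ler_wpM2r ?expR_ge0.
Qed.

(** The right-hand side is at least exp(L / 2), hence at least (1 + L / 4)^2, which exceeds 4 L once
    L >= 64. *)
Lemma log_bound (R : realType) (eta L D : R) :
  0 < eta -> eta <= 2^-1 -> 64 <= L -> expR (- (eta / 8) * L) <= D ->
  4 * L <= D ^+ 2 * expR L.
Proof.
move=> eta0 eta1 L64 DL.
have D2 : expR (- (eta / 8) * L) ^+ 2 <= D ^+ 2.
  by rewrite lerXn2r// nnegrE ?expR_ge0// (le_trans _ DL) ?expR_ge0.
apply: (@le_trans _ _ (expR (- (eta / 8) * L) ^+ 2 * expR L)); last first.
  by rewrite ler_wpM2r ?expR_ge0.
apply: (@le_trans _ _ (expR (L / 4) ^+ 2)).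
  have e1 : 0 <= 1 + L / 4 by lra.
  have e2 := expR_ge1Dx (L / 4).
  apply: (@le_trans _ _ ((1 + L / 4) ^+ 2)); first by nra.
  by rewrite lerXn2r// nnegrE expR_ge0.
rewrite !expr2 -!expRD ler_expR.
have : 0 <= (2^-1 - eta) * L by rewrite mulr_ge0 ?subr_ge0//; lra.
by nra.
Qed.

Theorem theorem1 (R : realType) (K : nat -> nat) (zeta : R)
    (hK : forall N, (0 < K N)%N) (hzeta : arms_growth K zeta)
    (M : forall N, bandit_model R (K N))
    (A : forall N, bandit_algorithm R (K N) (seed_space (M N)))
    (hA : uniformly_good A)
    (Delta : nat -> R) (hDelta : subpolynomial Delta) :
  ((1 - zeta)%:E <=
   limn_einf (fun N : nat =>
     ereal_inf [set regret (A N) N mu / (complexity mu * ln (N%:R : R))%:E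
               | mu in @Theta R (K N) (Delta (K N))]))%E.
Proof.
have [zeta0 zeta1] : 0 <= zeta /\ zeta < 1.
  by case: hzeta => [[z0 z1 _ _]|[-> _]]; split => //; exact: ltW.
apply/lee_subgt0Pr => e e0.
(* The three bounds serve [Theta_promoted], the loss of 6 eta in [lower_factor], and the sign of the
   exponent 1 - zeta - eta. *)
pose eta := Num.min (2^-1) (Num.min (e / 6) (1 - zeta)).
have eta0 : 0 < eta by rewrite !lt_min invr_gt0 divr_gt0 ?subr_gt0 ?ltr0n.
have eta1 : eta <= 2^-1 by rewrite ge_min lexx.
have eta_e : 6 * eta <= e.
  by rewrite mulrC -ler_pdivlMr// !ge_min lexx/= orbT.
have zeta_eta : zeta + eta <= 1.
  by rewrite -lerBrDl !ge_min lexx/= !orbT.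
have eta8 : 0 < eta / 8 by rewrite divr_gt0.
apply: limn_einf_ge.
(* The promoted means lie in the classes of the shifted gaps, so uniform goodness is used for that
   sequence. Goodness, the growth of [K] and the decay of [Delta] each get an error exponent eta /
   8. *)
have good := uniformly_good_le hK hA (subpolynomial_shifted_gap eta0 hDelta) eta8.
have arms := arms_growth_le hK hzeta eta8.
have gap := subpolynomial_ge hK hzeta hDelta eta8.
have L64 := @near_le_ln R 64.
have LC := @near_le_ln R (8 * (- ln eta / eta - ln (eta ^+ 2 / 2)) / (5 * eta)).
have Npos := nbhs_infty_gt 0.
apply: filterS3 (filterI good arms) (filterI gap L64) (filterI LC Npos).
move=> N [goodN armsN] [gapN L64N] [LCN N0].
apply: le_ereal_inf_tmp => _ [mu Dmu <-].
have D0 : 0 < Delta (K N) by case: hDelta => + _ _; exact.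
have L0 : 0 < ln (N%:R : R) by apply: lt_le_trans L64N.
have NE : N%:R = expR (ln (N%:R : R)) by rewrite lnK// posrE ltr0n.
have cL0 : 0 < complexity mu * ln (N%:R : R).
  by rewrite mulr_gt0// (complexity_gt0 (hK N) D0).
rewrite inver gt_eqF// lee_pdivlMr// -EFinB -EFinM.
apply: le_trans (@regret_lower_bound R (K N) (M N) (A N) N mu (Delta (K N)) eta
  (ln N%:R) (1 - zeta - eta) _ D0 eta0 eta1 (ltW L0) _ _ N0 _ goodN _ Dmu).
- rewrite lee_fin ler_wpM2r ?(ltW cL0)//.
  by apply: le_trans (lower_factor zeta0 eta0 eta1 zeta_eta); lra.
- by lra.
- by lra.
- by rewrite NE expRK; exact: log_bound eta0 eta1 L64N gapN.
- by rewrite [in leRHS]NE; apply: eta_exponent_bound.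
Qed.
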